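(* For every integer $n \ge 2$: (i) $D_n = h_4(n)$, and (ii) $D_{n+1} - D_n = h_2(n)$.
   Context: For a binary sequence $x = (x_1,\dots,x_n) \in \{0,1\}^n$ (1 = heads, 0 = tails) define the score $$S(x) = \sum_{i=1}^{n-1} I[x_i = x_{i+1} = 1] - \sum_{i=1}^{n-1} I[x_i = 1,\ x_{i+1} = 0].$$ Let $$D_n = \#\{x \in \{0,1\}^n : S(x) < 0\} - \#\{x \in \{0,1\}^n : S(x) > 0\}.$$ Let $h_2(n)$ be the number of $x \in \{0,1\}^n$ with $x_n = 1$ and $S(x) = 1$, and $h_4(n)$ the number of $x \in \{0,1\}^n$ with $x_n = 1$ and $S(x) = -1$. *)

(* Defs.v *)
From mathcomp Require Import all_boot all_order all_algebra.

Set Implicit Arguments.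
Unset Strict Implicit.
Unset Printing Implicit Defensive.

Import Order.TTheory GRing.Theory Num.Theory.
Local Open Scope ring_scope.

(* Heads is [true] and tails is [false].  Positions are 0-based, so x_i of the *)
(* 1-based convention is [bit x i.-1] and x_n is [bit x n.-1]; the default     *)
(* value of [nth] is never reached below when 0 < n.                           *)
Definition bit (n : nat) (x : n.-tuple bool) (i : nat) : bool := nth false x i.

Definition score (n : nat) (x : n.-tuple bool) : int :=
  \sum_(0 <= i < n.-1) (bit x i && bit x i.+1)%:Z
  - \sum_(0 <= i < n.-1) (bit x i && ~~ bit x i.+1)%:Z.

Definition D (n : nat) : int :=
  #|[set x : n.-tuple bool | score x < 0]|%:Z
  - #|[set x : n.-tuple bool | 0 < score x]|%:Z.

Definition h2 (n : nat) : nat :=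
  #|[set x : n.-tuple bool | bit x n.-1 && (score x == 1)]|.

Definition h4 (n : nat) : nat :=
  #|[set x : n.-tuple bool | bit x n.-1 && (score x == -1)]|.

(* Main.v *)
(* Appending a symbol to a word x gives D_{n+1} = 2 D_n - h4(n) + h2(n), so    *)
(* both claims reduce to h4(n+1) = h4(n) + h2(n).  The number of words ending  *)
(* in 1 with p pairs 11 and q pairs 10 is C(p+q, q) C(n-1-p-q, q); summing     *)
(* over q with p = q-1 (h4) or p = q+1 (h2), that identity holds term by term, *)
(* by Pascal's rule and the symmetry C(2q+1, q) = C(2q+1, q+1).                *)
Require Import Defs.
From mathcomp Require Import all_boot all_order all_algebra.
From mathcomp Require Import zify ring.

Set Implicit Arguments.
Unset Strict Implicit.
Unset Printing Implicit Defensive.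

Import Order.TTheory GRing.Theory Num.Theory.
Local Open Scope ring_scope.

(** Cut a word ending in heads, with p pairs 11 and q pairs 10, into runs: its q + 1 runs of heads
    share p extra heads, and its n - 1 - p - q tails fill q nonempty gaps and a possibly empty
    prefix. This explains the product of binomials in [word_countE], which is proved by removing the
    last letter. [word_count_step] is the resulting identity for each q, and summing it gives [h4S].
    Put into [D_rec], the hypothesis D n = h4 n yields D (n+1) = 2 h4 n - h4 n + h2 n = h4 (n+1), so
    [D_h4] follows by induction from the empty word, and each increment of D is h2 n. *)

Lemma big_tuple_rcons (R : Type) (idx : R) (op : Monoid.com_law idx)
    (T : finType) (n : nat) (F : n.+1.-tuple T -> R) :
  \big[op/idx]_x F x =
  \big[op/idx]_(x : n.-tuple T) \big[op/idx]_(b : T) F (rcons_tuple x b).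
Proof.
rewrite pair_big /=.
apply: (reindex (fun u : n.-tuple T * T => rcons_tuple u.1 u.2)).
apply: onW_bij; apply: inj_card_bij.
  move=> [x b] [y c] /(congr1 val) /= /rcons_inj [exy ->].
  by congr (_, _); apply: val_inj.
by rewrite card_prod !card_tuple expnSr.
Qed.

Lemma card_set_sum (T : finType) (P : pred T) :
  #|[set x | P x]| = (\sum_x P x)%N.
Proof.
by rewrite -sum1dep_card big_mkcond; apply: eq_bigr => x _; case: (P x).
Qed.

Lemma card_tuple_rcons (n : nat) (P : pred (n.+1.-tuple bool)) :
  #|[set x | P x]| = (#|[set x : n.-tuple bool | P (rcons_tuple x true)]|
                      + #|[set x : n.-tuple bool | P (rcons_tuple x false)]|)%N.
Proof.
rewrite !card_set_sum big_tuple_rcons -big_split /=.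
by apply: eq_bigr => x _; rewrite big_bool.
Qed.

Definition heads_heads (n : nat) (x : n.-tuple bool) : nat :=
  (\sum_(0 <= i < n.-1) (bit x i && bit x i.+1))%N.

Definition heads_tails (n : nat) (x : n.-tuple bool) : nat :=
  (\sum_(0 <= i < n.-1) (bit x i && ~~ bit x i.+1))%N.

(* For [n = 0] this is [false]: the empty word behaves as if it ended in tails. *)
Definition last_bit (n : nat) (x : n.-tuple bool) : bool := bit x n.-1.

Lemma scoreE (n : nat) (x : n.-tuple bool) :
  score x = (heads_heads x)%:Z - (heads_tails x)%:Z.
Proof. by rewrite /score -!(big_morph Posz PoszD (erefl 0%:Z)). Qed.

Lemma heads_tails_lt (n : nat) (x : n.-tuple bool) : (heads_tails x < n.+1)%N.
Proof.
rewrite ltnS (leq_trans _ (leq_pred n)) // /heads_tails.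
rewrite (@leq_trans (\sum_(0 <= i < n.-1) 1)%N) ?leq_sum // => [i _|].
  exact: leq_b1.
by rewrite sum_nat_const_nat muln1 subn0.
Qed.

Lemma bit_rcons (n : nat) (x : n.-tuple bool) (b : bool) (i : nat) :
  bit (rcons_tuple x b) i = if (i < n)%N then bit x i else (i == n) && b.
Proof.
by rewrite /bit /= nth_rcons size_tuple; case: (i < n)%N => //; case: (i == n).
Qed.

Lemma last_bit_rcons (n : nat) (x : n.-tuple bool) (b : bool) :
  last_bit (rcons_tuple x b) = b.
Proof. by rewrite /last_bit bit_rcons ltnn eqxx. Qed.

(** The hypothesis serves n = 0: no pair precedes the new letter and [last_bit] of the empty word
    defaults to [false], so the extra term must vanish. *)
Lemma sum_bit_rcons (f : bool -> bool -> bool) (n : nat) (x : n.-tuple bool)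
    (b : bool) :
  f false b = false ->
  (\sum_(0 <= i < n.+1.-1) f (bit (rcons_tuple x b) i)
                             (bit (rcons_tuple x b) i.+1) =
   \sum_(0 <= i < n.-1) f (bit x i) (bit x i.+1) + f (last_bit x) b)%N.
Proof.
case: n x => [|n] x f0 /=.
  by rewrite tuple0 !big_geq // /last_bit /bit /= f0.
rewrite big_nat_recr //= !bit_rcons ltnSn ltnn eqxx; congr (_ + _)%N.
apply: eq_big_nat => i /andP[_ ltin].
by rewrite !bit_rcons (ltin : i.+1 < n.+1)%N (ltnW ltin : i < n.+1)%N.
Qed.

Lemma heads_heads_rcons (n : nat) (x : n.-tuple bool) (b : bool) :
  heads_heads (rcons_tuple x b) = (heads_heads x + (last_bit x && b))%N.
Proof. exact: (@sum_bit_rcons andb). Qed.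

Lemma heads_tails_rcons (n : nat) (x : n.-tuple bool) (b : bool) :
  heads_tails (rcons_tuple x b) = (heads_tails x + (last_bit x && ~~ b))%N.
Proof. exact: (@sum_bit_rcons (fun u v => u && ~~ v)). Qed.

Definition word_count (n : nat) (c : bool) (p q : nat) : nat :=
  #|[set x : n.-tuple bool |
      [&& last_bit x == c, heads_heads x == p & heads_tails x == q]]|.

Lemma word_countS_true (n p q : nat) :
  word_count n.+1 true p q =
  ((if p is p'.+1 then word_count n true p' q else 0)
   + word_count n false p q)%N.
Proof.
rewrite /word_count card_tuple_rcons.
rewrite [X in (_ + X)%N](_ : _ = 0)%N ?addn0; last first.
  by apply: eq_card0 => x; rewrite !inE last_bit_rcons.
rewrite card_set_sum; case: p => [|p]; rewrite !card_set_sum.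
  rewrite add0n; apply: eq_bigr => x _.
  rewrite last_bit_rcons heads_heads_rcons heads_tails_rcons.
  by case: last_bit; rewrite /= ?andbF ?addn0 ?addn1.
rewrite -big_split; apply: eq_bigr => x _ /=.
rewrite last_bit_rcons heads_heads_rcons heads_tails_rcons.
by case: last_bit; rewrite /= ?andbF ?addn0 ?addn1 ?eqSS.
Qed.

Lemma word_countS_false (n p q : nat) :
  word_count n.+1 false p q =
  (word_count n false p q
   + (if q is q'.+1 then word_count n true p q' else 0))%N.
Proof.
rewrite /word_count card_tuple_rcons.
rewrite [X in (X + _)%N](_ : _ = 0)%N ?add0n; last first.
  by apply: eq_card0 => x; rewrite !inE last_bit_rcons.
rewrite card_set_sum; case: q => [|q]; rewrite !card_set_sum.
  rewrite addn0; apply: eq_bigr => x _.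
  rewrite last_bit_rcons heads_heads_rcons heads_tails_rcons.
  by case: last_bit; rewrite /= ?addn0 ?addn1 ?andbF.
rewrite -big_split; apply: eq_bigr => x _ /=.
rewrite last_bit_rcons heads_heads_rcons heads_tails_rcons.
by case: last_bit; rewrite /= ?andbF ?addn0 ?addn1 ?eqSS.
Qed.

Lemma word_count0 (c : bool) (p q : nat) :
  word_count 0 c p q = [&& ~~ c, p == 0 & q == 0]%N.
Proof.
rewrite /word_count card_set_sum (big_pred1 [tuple]); last first.
  by move=> x; apply/esym/eqP/tuple0.
rewrite /last_bit /heads_heads /heads_tails !big_geq //.
by rewrite /bit /= !(eq_sym 0%N); case: c.
Qed.

(* Truncation: the factor [p + q < n] matters when [q = 0], and [(p + q).-1]    *)
(* makes the second formula equal to [p == 0] when [q = 0].                     *)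
Lemma word_countE (n p q : nat) :
  (word_count n true p q =
     (p + q < n) * ('C(p + q, q) * 'C(n.-1 - (p + q), q)) /\
   word_count n false p q = 'C((p + q).-1, p) * 'C(n - (p + q), q))%N.
Proof.
elim: n p q => [|n IH] p q.
  rewrite !word_count0 /= sub0n; split=> //.
  by case: q => [|q]; case: p => [|p]; rewrite ?addn0 ?bin0 ?bin0n ?muln0 //= bin_small.
rewrite word_countS_true word_countS_false; split.
  rewrite (IH p q).2; case: p => [|p].
    rewrite !add0n binn bin0 !mul1n ltnS /=.
    case: leqP => [_|lt_nq]; first by rewrite mul1n.
    by rewrite bin_small //; lia.
  rewrite (IH p q).1 !addSn /= ltnS.
  have -> : (n.-1 - (p + q) = n - (p + q).+1)%N by lia.
  case: q => [|q].
    by rewrite !addn0 !bin0 (bin_small (ltnSn p)) mul0n addn0.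
  case: (ltnP (p + q.+1) n) => [_|le_n].
    (* Pascal's rule acts here on the first factor, which distributes the extra heads. *)
    rewrite !mul1n -mulnDl binS; congr (_ * _)%N; congr (_ + _)%N.
    by rewrite -(bin_sub (n := p + q.+1) (m := p.+1)); [congr 'C(_, _) |]; lia.
  have -> : (n - (p + q.+1).+1 = 0)%N by lia.
  by rewrite bin0n !muln0.
rewrite (IH p q).2; case: q => [|q].
  by rewrite !addn0 !bin0.
rewrite (IH p q).1 addnS /=.
case: (ltnP (p + q) n) => [lt_n|le_n].
  have -> : (n.+1 - (p + q).+1 = (n - (p + q).+1).+1)%N by lia.
  have -> : (n.-1 - (p + q) = n - (p + q).+1)%N by lia.
  (* For words ending in tails, Pascal's rule acts instead on the second factor, which distributes
     the tails. *)
  rewrite mul1n binS mulnDr; congr (_ + _ * _)%N.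
  by rewrite -(bin_sub (n := p + q) (m := q)); [congr 'C(_, _)|]; lia.
by rewrite !(bin_small (m := q.+1)) ?muln0 //; lia.
Qed.

Lemma word_count_step (n q : nat) :
  word_count n.+1 true q q.+1 =
  (word_count n true q q.+1 + word_count n true q.+1 q)%N.
Proof.
rewrite !(word_countE _ _ _).1 addSn addnS /=.
have -> : 'C((q + q).+1, q.+1) = 'C((q + q).+1, q).
  by rewrite -bin_sub; [congr 'C(_, _)|]; lia.
case: (ltnP (q + q).+1 n) => [lt_n|le_n].
  rewrite (leqW lt_n) !mul1n -mulnDr -binS.
  by congr (_ * 'C(_, _))%N; lia.
(* At n = 2q + 1 the guard on the left still holds; the factor C(0, q + 1) = 0 makes the term
   vanish. *)
have -> : (n - (q + q).+1 = 0)%N by lia.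
by rewrite bin0n !muln0.
Qed.

Lemma h2_sum (n : nat) :
  h2 n = (\sum_(q < n.+2) word_count n true q.+1 q)%N.
Proof.
rewrite /h2 /word_count card_set_sum.
under [RHS]eq_bigr do rewrite card_set_sum.
rewrite exchange_big /=; apply: eq_bigr => x _.
have ht_lt : (heads_tails x < n.+2)%N := leqW (heads_tails_lt x).
rewrite (bigD1 (Ordinal ht_lt)) //= big1 ?addn0 => [|q neq_q].
  rewrite scoreE eqxx andbT eqb_id; congr (nat_of_bool (_ && _)); lia.
apply/eqP; rewrite eqb0; apply: contraNN neq_q => /and3P[_ _ /eqP ht_q].
by apply/eqP/val_inj.
Qed.

(** The free bound m lets [h4S] sum over one index range for both lengths n and n + 1, the range
    used in [h2_sum]. *)
Lemma h4_sum (n m : nat) : (n <= m)%N ->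
  h4 n = (\sum_(q < m.+1) word_count n true q q.+1)%N.
Proof.
move=> le_nm; rewrite /h4 /word_count card_set_sum.
under [RHS]eq_bigr do rewrite card_set_sum.
rewrite exchange_big /=; apply: eq_bigr => x _.
have ht_lt := heads_tails_lt x.
(* The only index that can count x is its number of pairs 10 minus one. If x has no such pair, the
   predecessor truncates to 0, harmlessly: the score is then nonnegative and both sides are 0. *)
have pred_lt : ((heads_tails x).-1 < m.+1)%N by lia.
rewrite (bigD1 (Ordinal pred_lt)) //= big1 ?addn0 => [|q neq_q].
  rewrite scoreE eqb_id; congr (nat_of_bool (_ && _)); lia.
apply/eqP; rewrite eqb0; apply: contraNN neq_q => /and3P[_ _ /eqP ht_q].
by apply/eqP/val_inj; rewrite /= ht_q.
Qed.

Lemma h4S (n : nat) : h4 n.+1 = (h4 n + h2 n)%N.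
Proof.
rewrite h2_sum (h4_sum (leqnn n.+1)) (h4_sum (leqnSn n)) -big_split.
by apply: eq_bigr => q _; rewrite word_count_step.
Qed.

Lemma D_sgz (n : nat) : D n = - \sum_(x : n.-tuple bool) sgz (score x).
Proof.
rewrite /D !card_set_sum !(big_morph Posz PoszD (erefl 0%:Z)) -sumrB -sumrN.
by apply: eq_bigr => x _ /=; case: sgzP.
Qed.

(** After heads, the new letter moves the score s to s + 1 or s - 1, and sgn(s + 1) + sgn(s - 1) = 2
    sgn(s) except at s = 1 and s = -1, where the sum is off by -1 and +1. After tails, the score is
    unchanged. *)
Lemma D_rec (n : nat) : D n.+1 = D n *+ 2 - (h4 n)%:Z + (h2 n)%:Z.
Proof.
rewrite !D_sgz big_tuple_rcons /h4 /h2 !card_set_sum.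
rewrite !(big_morph Posz PoszD (erefl 0%:Z)).
rewrite mulr2n -!sumrN -!big_split; apply: eq_bigr => x _ /=.
rewrite big_bool !scoreE !heads_heads_rcons !heads_tails_rcons -/(last_bit x).
case: last_bit; rewrite /= ?addn0; lia.
Qed.

Lemma D_h4 (n : nat) : D n = (h4 n)%:Z.
Proof.
elim: n => [|n IH]; last by rewrite D_rec IH h4S PoszD; ring.
rewrite D_sgz /h4 card_set_sum !(big_pred1 [tuple]) => [|x|x]; first last.
- by apply/esym/eqP/tuple0.
- by apply/esym/eqP/tuple0.
by rewrite /score !big_geq.
Qed.

Theorem theorem1 (n : nat) (hn : (2 <= n)%N) :
  D n = (h4 n)%:Z /\ D n.+1 - D n = (h2 n)%:Z.
Proof.
by rewrite D_rec D_h4 //; split=> //; ring.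
Qed.
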